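(* Let $n\ge1$ and $N=2^n$. Let $\rho_0=(|+\rangle\langle+|)^{\otimes n}$ and, for $1\le j\le n$, $\rho_j=\tau^{\otimes(j-1)}\otimes|0\rangle\langle0|\otimes\tau^{\otimes(n-j)}$, as density matrices on $(\mathbb{C}^2)^{\otimes n}\cong\mathbb{C}^N$. If $U$ and $V$ are unitaries on $\mathbb{C}^N$ satisfying $U\rho_iU^\dagger=V\rho_iV^\dagger$ for all $0\le i\le n$, then $U=V$ up to a global phase, i.e. $V=e^{i\theta}U$ for some $\theta\in\mathbb{R}$.
   Context: $|0\rangle,|1\rangle$ is the standard (computational) basis of $\mathbb{C}^2$, $|+\rangle=\frac1{\sqrt2}(|0\rangle+|1\rangle)$, and $\tau=\frac12 I_2$ is the single-qubit maximally mixed state. *)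

(* Defs.v *)
(* The field of complex numbers is R[i] for R : realType; the states below make
   sense over any numClosedFieldType. *)
From mathcomp Require Export all_boot all_order all_algebra.
From mathcomp Require Export spectral.
From mathcomp Require Export complex mxtens.
From mathcomp Require Export reals trigo.

Set Implicit Arguments.
Unset Strict Implicit.
Unset Printing Implicit Defensive.

Import Order.TTheory GRing.Theory Num.Theory.

Local Open Scope ring_scope.
Local Open Scope sesquilinear_scope.

Section States.
Variable C : numClosedFieldType.

Definition ket0 : 'cV[C]_2 := delta_mx 0 0.
Definition ket1 : 'cV[C]_2 := delta_mx 1 0.
Definition ket_plus : 'cV[C]_2 := (sqrtC 2)^-1 *: (ket0 + ket1).

Definition projector m (v : 'cV[C]_m) : 'M[C]_m := v *m v ^t*.

Definition maximally_mixed : 'M[C]_2 := 2^-1 *: 1%:M.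

Lemma dim_split n (j : 'I_n) : (2 ^ j * (2 * 2 ^ rev_ord j) = 2 ^ n)%N.
Proof. by rewrite -expnS -expnD /= addnS -addSn subnKC. Qed.

(* [j] is 0-based: [j] sites to the left of the distinguished one and
   [rev_ord j = n - j.+1] to its right.
   [ntensmx] is the tensor power; its notation [A ^t k] clashes with the
   transpose-and-map notation [M ^t f] of sesquilinear_scope. *)
Definition rho_site n (j : 'I_n) : 'M[C]_(2 ^ n) :=
  castmx (dim_split j, dim_split j)
    (ntensmx maximally_mixed j *t
       (projector ket0 *t ntensmx maximally_mixed (rev_ord j))).

(* Index 0 is the global plus state; index [j.+1] is the site state at [j]. *)
Definition rho n (i : 'I_n.+1) : 'M[C]_(2 ^ n) :=
  if unlift ord0 i is Some j then rho_site j else ntensmx (projector ket_plus) n.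

End States.

(* Main.v *)
(* The unitary W = U^* V commutes with every rho_i. Up to a factor, the site
   states are the diagonal 0/1 matrices reading off the binary digits of the
   basis index; digits separate indices, so W is diagonal. The plus state is a
   nonzero constant matrix, and a diagonal matrix commuting with it is scalar. *)
Require Import Defs.

Set Implicit Arguments.
Unset Strict Implicit.
Unset Printing Implicit Defensive.

Import Order.TTheory GRing.Theory Num.Theory.

Local Open Scope ring_scope.
Local Open Scope sesquilinear_scope.
Local Open Scope complex_scope.

(** Induction strips the lowest bit: the bits of the halves are those of [x] and [y] shifted by one,
    and [k = 0] gives the parities. *)
Lemma eq_from_bits n (x y : nat) :
  (x < 2 ^ n)%N -> (y < 2 ^ n)%N ->
  (forall k, (k < n)%N -> odd (x %/ 2 ^ k) = odd (y %/ 2 ^ k))%N -> x = y.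
Proof.
elim: n x y => [|n IHn] x y; first by rewrite expn0 !ltnS !leqn0 => /eqP-> /eqP->.
rewrite expnSr => ltx lty eq_bits.
have eq_half : (x %/ 2)%N = (y %/ 2)%N.
  apply: IHn => [||k ltkn]; rewrite ?ltn_divLR // -!divnMA -expnS.
  exact: eq_bits.
rewrite (divn_eq x 2) (divn_eq y 2) eq_half !modn2.
by have := eq_bits 0 isT; rewrite !divn1 => ->.
Qed.

Section TensorPower.
Variable R : pzRingType.

Lemma const_mx_tens m n p q (a b : R) :
  const_mx a *t const_mx b = const_mx (a * b) :> 'M_(m * p, n * q).
Proof. by apply/matrixP=> i j; rewrite !mxE. Qed.

Lemma ntensmx_const m n (a : R) k :
  ntensmx (const_mx a : 'M_(m, n)) k = const_mx (a ^+ k).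
Proof.
elim: k => [|[|k] IHk].
- by apply/matrixP=> i j; rewrite ntensmx0 !mxE !ord1 eqxx.
- by rewrite ntensmx1.
- by rewrite ntensmxSS IHk const_mx_tens -exprS.
Qed.

Lemma diag_mx_tens m n (d : 'rV[R]_m) (e : 'rV[R]_n) :
  diag_mx d *t diag_mx e =
  diag_mx (\row_k (d 0 (mxtens_unindex k).1 * e 0 (mxtens_unindex k).2)).
Proof.
apply/matrixP=> i j; rewrite !mxE mulrnAl mulrnAr -mulrnA mulnb.
congr (_ *+ nat_of_bool _); apply/andP/eqP => [[/eqP[eq2] /eqP[eq1]]|-> //].
by apply: val_inj; rewrite /= (divn_eq i n) (divn_eq j n) eq1 eq2.
Qed.

Lemma scalar_mx_tens m n (a b : R) : a%:M *t b%:M = (a * b)%:M :> 'M_(m * n).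
Proof.
by rewrite -!diag_const_mx diag_mx_tens; congr diag_mx; apply/rowP=> k;
   rewrite !mxE.
Qed.

Lemma ntensmx_scalar m (a : R) k : ntensmx (a%:M : 'M_m) k = (a ^+ k)%:M.
Proof.
elim: k => [|[|k] IHk].
- by rewrite ntensmx0.
- by rewrite ntensmx1.
- by rewrite ntensmxSS IHk scalar_mx_tens -exprS.
Qed.

End TensorPower.

Section RhoEntries.
Variable C : numClosedFieldType.

Lemma projector_ket_plus : projector (ket_plus C) = const_mx 2^-1.
Proof.
apply/matrixP=> i j; rewrite mxE big_ord1 !mxE !eqxx !andbT.
have ket_sum (k : 'I_2) : (k == 0)%:R + (k == 1)%:R = 1 :> C.
  by case: k => [[|[|k]] lek] //=; rewrite ?addr0 ?add0r.
rewrite !ket_sum !mulr1 conj_Creal; last by rewrite rpredV ger0_real ?sqrtC_ge0 ?ler0n.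
by rewrite -invfM -expr2 sqrtCK.
Qed.

(** Writing the diagonal through parity turns it into a binary digit once the index of a tensor
    product is split. *)
Lemma projector_ket0 :
  projector (ket0 C) = diag_mx (\row_i (~~ odd i)%:R).
Proof.
apply/matrixP=> i j; rewrite mxE big_ord1 !mxE !eqxx !andbT conjC_nat.
by case: i j => [[|[|i]] lei] // [[|[|j]] lej]; rewrite //= ?mulr0 ?mul0r ?mulr1.
Qed.

Lemma rho0 n : rho C (ord0 : 'I_n.+1) = const_mx (2^-1 ^+ n).
Proof. by rewrite /rho unlift_none projector_ket_plus ntensmx_const. Qed.

(** Each of the [n.-1] mixed sites contributes a factor 1/2. The leftmost tensor factor is the most
    significant digit, so site [j] reads the bit of weight [2 ^ rev_ord j]. *)
Lemma rho_siteE n (j : 'I_n) x y :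
  rho_site C j x y =
  2^-1 ^+ n.-1 *+ ((x == y) && ~~ odd (x %/ 2 ^ rev_ord j)%N).
Proof.
rewrite /rho_site /maximally_mixed scalemx1 !ntensmx_scalar -!diag_const_mx.
rewrite projector_ket0 !diag_mx_tens castmxE !mxE (inj_eq (@cast_ord_inj _ _ _)) /=.
rewrite mulrCA mulr_natl -!mulrnA mulnC.
(* The middle index is [x] modulo [2 * 2 ^ rev_ord j], divided by [2 ^ rev_ord j]: a single bit of
   [x]. *)
rewrite mulnb -modn_divl modn2 oddb -exprD.
have -> // : (j + (n - j.+1) = n.-1)%N.
have := ltn_ord j; move: (nat_of_ord j) => k; case: (n) => // m.
by rewrite ltnS subSS => /subnKC.
Qed.

End RhoEntries.

(** For diagonal [W], the entry [(z, t)] of the commutation relation reads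
    [W z z * c = c * W t t]. *)
Lemma comm_const_diag_scalar (F : fieldType) n (c : F) (W : 'M_n.+1) :
  c != 0 -> is_diag_mx W -> W *m const_mx c = const_mx c *m W ->
  W = (W 0 0)%:M.
Proof.
move=> c_neq0 /is_diag_mxP diagW commW; apply/matrixP=> x y; rewrite !mxE.
have W_const (z t : 'I_n.+1) : W z z = W t t.
  have /matrixP/(_ z t) := commW; rewrite !mxE.
  rewrite (bigD1 z) //= big1 ?addr0 => [|k neq_kz]; last first.
    by rewrite diagW ?mul0r // eq_sym.
  rewrite (bigD1 t) //= big1 ?addr0 => [|k neq_kz]; last first.
    by rewrite diagW ?mulr0.
  by rewrite !mxE mulrC => /(mulfI c_neq0).
have [->|neq_xy] := eqVneq x y; last by rewrite diagW.
by rewrite mulr1n (W_const y 0).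
Qed.

Lemma comm_rho_scalar (C : numClosedFieldType) n (W : 'M[C]_(2 ^ n)) :
  (forall i : 'I_n.+1, W *m rho C i = rho C i *m W) ->
  exists c, W = c%:M.
Proof.
move=> commW.
have diagW : is_diag_mx W.
  (* By contraposition: a nonzero [W x y] can be cancelled from the entry [(x, y)] of each
     commutation relation, so [x] and [y] share all their bits. *)
  apply/is_diag_mxP => x y neq_xy; apply/eqP; apply: contra_neqT neq_xy => Wxy.
  apply: (@eq_from_bits n) => // k ltkn.
  (* Reversal picks the site whose digit has weight [2 ^ k]. *)
  pose j := rev_ord (Ordinal ltkn).
  have /matrixP/(_ x y) := commW (lift ord0 j).
  rewrite /rho liftK !mxE.
  rewrite (bigD1 y) //= big1 ?addr0 => [|z neq_zy]; last first.
    by rewrite rho_siteE (negPf neq_zy) mulr0.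
  rewrite (bigD1 x) //= big1 ?addr0 => [|z neq_zx]; last first.
    by rewrite rho_siteE eq_sym (negPf neq_zx) mul0r.
  rewrite !rho_siteE !eqxx rev_ordK /= mulrC => /(mulIf Wxy).
  have c_neq0 : 2^-1 ^+ n.-1 != 0 :> C by rewrite expf_neq0 // invr_eq0 pnatr_eq0.
  rewrite -mulr_natr -[RHS]mulr_natr => /(mulfI c_neq0)/eqP; rewrite eqr_nat.
  by do 2!case: odd.
have c_neq0 : 2^-1 ^+ n != 0 :> C by rewrite expf_neq0 // invr_eq0 pnatr_eq0.
have := commW ord0; rewrite rho0.
(* The dimension is turned into a successor [N.+1], so that the index 0 exists. *)
have := prednK (expn_gt0 2 n); move: (2 ^ n).-1 => N eqN.
case: _ / eqN in W {commW} diagW *.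
by move/comm_const_diag_scalar => W_scalar; exists (W 0 0); apply: W_scalar.
Qed.

Lemma unit_complex_polar (R : realType) (z : R[i]) :
  `|z| = 1 -> exists theta, z = cos theta +i* sin theta.
Proof.
case: z => a b /eqP; rewrite normc_def /= => /eqP[].
move/(congr1 (fun x => x ^+ 2)); rewrite expr1n sqr_sqrtr ?addr_ge0 ?sqr_ge0 // => ab1.
have a_le1 : -1 <= a <= 1.
  by rewrite -ler_norml -(@expr_le1 _ 2) // real_normK ?num_real // -ab1 lerDl sqr_ge0.
have sinE : sin (acos a) = `|b|.
  by rewrite sin_acos // -ab1 [a ^+ 2 + _]addrC addrK sqrtr_sqr.
(* [acos] only yields a nonnegative sine, so the sign of [b] decides the sign of the angle. *)
have [b_ge0|/ltW b_le0] := leP 0 b.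
  by exists (acos a); rewrite acosK // sinE ger0_norm.
by exists (- acos a); rewrite cosN sinN acosK // sinE ler0_norm // opprK.
Qed.

Theorem proposition2 (R : realType) (n : nat) (n_gt0 : (0 < n)%N)
    (U V : 'M[R[i]]_(2 ^ n)) (U_unitary : U \is unitarymx)
    (V_unitary : V \is unitarymx)
    (same_images : forall i : 'I_n.+1,
      U *m rho R[i] i *m U ^t* = V *m rho R[i] i *m V ^t*) :
  exists theta : R, V = (cos theta +i* sin theta) *: U.
Proof.
have [c Wc] : exists c, U ^t* *m V = c%:M.
  apply: comm_rho_scalar => i.
  (* Unitarity of [U] cancels on the left side and that of [V] on the right, leaving the commutation
     of [U ^t* *m V] with [rho R[i] i]. *)
  have := congr1 (fun M => U ^t* *m M *m V) (same_images i).
  rewrite !mulmxA !mulmxKtV // -[U ^t* *m U]mul1mx mulmxA mulmxKtV // mul1mx.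
  by rewrite -mulmxA => ->.
have V_eq : V = c *: U.
  by rewrite -mul_mx_scalar -Wc mulmxA (unitarymxP U_unitary) mul1mx.
have norm_c : `|c| = 1.
  (* The scalar matrix of [c] is a product of unitaries; any diagonal entry of its unitarity
     relation gives [|c|^2 = 1]. *)
  have := mul_unitarymx (etrans (trmxC_unitary U) U_unitary) V_unitary.
  rewrite Wc => /unitarymxP; rewrite tr_scalar_mx map_scalar_mx -scalar_mxM.
  move/matrixP/(_ (Ordinal (expn_gt0 2 n)) (Ordinal (expn_gt0 2 n))).
  by rewrite !mxE eqxx => /eqP; rewrite !mulr1n -normCK sqrp_eq1 // => /eqP.
by have [theta c_eq] := unit_complex_polar norm_c; exists theta; rewrite -c_eq.
Qed.
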